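(* Let $n,N,l$ be positive integers, let $A_1,\ldots,A_N,B_1,\ldots,B_N\in\mathbb{R}^{n\times n}$ be (entrywise) nonnegative matrices, let $f:\mathbb{R}^n\to\mathbb{R}^n$ be an admissible diagonal nonlinearity with components $f_1,\ldots,f_n$, and let $u(k)\in\mathbb{R}^n$, $k\ge 0$, be a bounded input. Let $f_i(x_i)\to-\infty$ as $x_i\to-\infty$ and $f_i(x_i)\to+\infty$ as $x_i\to+\infty$, $i=1,\ldots,n$. Assume that there exist numbers $\mu>0$, $\lambda>0$ and vectors $d^{(1)}\gg 0,\ldots,d^{(N)}\gg 0$, $\theta\gg 0$ in $\mathbb{R}^n$ such that $$A_s^Td^{(r)}+B_m^Td^{(j)}\le\mu d^{(s)},\qquad s,r,m,j=1,\ldots,N,$$ $$(A_s+B_s)\theta\le\lambda\theta,\qquad s=1,\ldots,N,$$ $$\lambda\mu<1.$$ Then there exists a switched diagonal Lyapunov--Krasovskii functional of the form $$\widetilde V(k,x^{(k)})=x^T(k)P^{(\sigma(k))}x(k)+f^T(x(k-1))Q_1f(x(k-1))+f^T(x(k-2))Q_2f(x(k-2))+\ldots+f^T(x(k-l))Q_lf(x(k-l)),$$ with $P^{(1)},\ldots,P^{(N)},Q_1,\ldots,Q_l$ positive definite diagonal matrices, guaranteeing uniform ultimate boundedness of the switched system $$x(k+1)=A_{\sigma(k)}f(x(k))+B_{\sigma(k)}f(x(k-l))+u(k).$$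
   Context: Vector inequalities are componentwise: $v\le w$ means $v_i\le w_i$ for all $i$, and $v\gg 0$ means $v_i>0$ for all $i$. $\|\cdot\|$ is the Euclidean norm. An admissible diagonal nonlinearity is a continuous map $f:\mathbb{R}^n\to\mathbb{R}^n$ of the form $f(x)=(f_1(x_1),\ldots,f_n(x_n))^T$ such that for each $i$: $x_if_i(x_i)>0$ for all $x_i\ne 0$, and $|f_i(x_i)|\le|x_i|$ for all $x_i$. The integer $l$ is the delay. The switching signal $\sigma$ maps the nonnegative integers to $\{1,\ldots,N\}$. Write $x^{(k)}=(x^T(k),x^T(k-1),\ldots,x^T(k-l))^T\in\mathbb{R}^{(l+1)n}$, and let $x(k,x^{(k_0)},k_0)$ denote the solution of the switched system with initial conditions $k_0\ge 0$, $x^{(k_0)}\in\mathbb{R}^{(l+1)n}$. The switched system is uniformly ultimately bounded with the ultimate bound $R$ if, for any $D>0$, there exists a positive integer $\tilde k$ such that $\|x(k,x^{(k_0)},k_0)\|\le R$ for all $k_0\ge 0$, $\|x^{(k_0)}\|\le D$, $k\ge\tilde k+k_0$ and for arbitrary switching law $\sigma$. *)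

(* Defs.v *)
From HB Require Import structures.
From mathcomp Require Import all_boot all_order all_algebra.
From mathcomp Require Import all_classical all_reals all_analysis.
Set Implicit Arguments.
Unset Strict Implicit.
Unset Printing Implicit Defensive.
Import Order.TTheory GRing.Theory Num.Theory.
Import numFieldNormedType.Exports.
Local Open Scope classical_set_scope.
Local Open Scope ring_scope.

(* The library norm `|x| on matrices is the sup norm, hence a separate
   Euclidean norm. *)
Definition enorm (R : realType) (p : nat) (x : 'cV[R]_p) : R :=
  Num.sqrt (\sum_(i < p) x i 0 ^+ 2).

Definition vle (R : realType) (p : nat) (v w : 'cV[R]_p) : Prop :=
  forall i, v i 0 <= w i 0.

Definition vpos (R : realType) (p : nat) (v : 'cV[R]_p) : Prop :=
  forall i, 0 < v i 0.

Definition mx_nonneg (R : realType) (p q : nat) (A : 'M[R]_(p, q)) : Prop :=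
  forall i j, 0 <= A i j.

Definition qform (R : realType) (p : nat) (P : 'M[R]_p) (x : 'cV[R]_p) : R :=
  (x^T *m P *m x) 0 0.

Definition posdef (R : realType) (p : nat) (P : 'M[R]_p) : Prop :=
  P^T = P /\ forall x : 'cV[R]_p, x != 0 -> 0 < qform P x.

Definition diag_map (R : realType) (n : nat) (f : 'I_n -> R -> R)
    (x : 'cV[R]_n) : 'cV[R]_n :=
  \col_(i < n) f i (x i 0).

Definition admissible (R : realType) (n : nat) (f : 'I_n -> R -> R) : Prop :=
  [/\ continuous (diag_map f),
      forall i (t : R), t != 0 -> 0 < t * f i t
    & forall i (t : R), `|f i t| <= `|t| ].

Definition bounded_input (R : realType) (n : nat) (u : nat -> 'cV[R]_n) : Prop :=
  exists M : R, forall k, enorm (u k) <= M.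

(* Trajectories are indexed by int, since the initial data at time k0 involve
   the times k0 - l, ..., k0, which may be negative. *)
Definition segment (R : realType) (n l : nat) (x : int -> 'cV[R]_n) (k : int) :
    'cV[R]_(l.+1 * n) :=
  (mxvec (\matrix_(i < l.+1, j < n) x (k - i%:Z) j 0))^T.

Definition block (R : realType) (n l : nat) (phi : 'cV[R]_(l.+1 * n))
    (i : 'I_l.+1) : 'cV[R]_n :=
  \col_(j < n) phi (mxvec_index i j) 0.

Lemma block_segment (R : realType) (n l : nat) (x : int -> 'cV[R]_n) (k : int)
    (i : 'I_l.+1) : block (segment l x k) i = x (k - i%:Z).
Proof. by apply/colP => j; rewrite !mxE mxvecE mxE. Qed.

Definition is_solution (R : realType) (n N l : nat)
    (A B : 'I_N -> 'M[R]_n) (f : 'I_n -> R -> R) (u : nat -> 'cV[R]_n)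
    (sigma : nat -> 'I_N) (k0 : nat) (x : int -> 'cV[R]_n) : Prop :=
  forall k : nat, (k0 <= k)%N ->
    x k.+1%:Z = A (sigma k) *m diag_map f (x k%:Z)
              + B (sigma k) *m diag_map f (x (k%:Z - l%:Z)) + u k.

Definition uniformly_ultimately_bounded (R : realType) (n N l : nat)
    (A B : 'I_N -> 'M[R]_n) (f : 'I_n -> R -> R) (u : nat -> 'cV[R]_n)
    (Rb : R) : Prop :=
  forall D : R, 0 < D ->
    exists2 kt : nat, (0 < kt)%N &
      forall (sigma : nat -> 'I_N) (k0 : nat) (x : int -> 'cV[R]_n),
        is_solution l A B f u sigma k0 x ->
        enorm (segment l x k0%:Z) <= D ->
        forall k : nat, (kt + k0 <= k)%N -> enorm (x k%:Z) <= Rb.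

(* Q i stands for the matrix Q_(i+1); it is paired with the delayed value
   x(k - (i+1)), which is the block of index lift ord0 i. *)
Definition switched_LK (R : realType) (n N l : nat)
    (P : 'I_N -> 'M[R]_n) (Q : 'I_l -> 'M[R]_n) (f : 'I_n -> R -> R)
    (sigma : nat -> 'I_N) (k : nat) (phi : 'cV[R]_(l.+1 * n)) : R :=
  qform (P (sigma k)) (block phi ord0)
  + \sum_(i < l) qform (Q i) (diag_map f (block phi (lift ord0 i))).

Definition class_K (R : realType) (a : R -> R) : Prop :=
  [/\ {within `[0, +oo[, continuous a}, a 0 = 0
    & forall s t : R, 0 <= s -> s < t -> a s < a t].

Definition class_Koo (R : realType) (a : R -> R) : Prop :=
  class_K a /\ a t @[t --> +oo] --> +oo.

(* The Lyapunov-Krasovskii conditions for ultimate boundedness: V is positive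
   definite, radially unbounded and decrescent, and outside a ball of the state
   space its increment along solutions is bounded by - a3 with a3 of class K.
   The comparison functions and the radius depend neither on the time nor on
   the switching law. *)
Definition LK_conditions (R : realType) (n N l : nat)
    (A B : 'I_N -> 'M[R]_n) (f : 'I_n -> R -> R) (u : nat -> 'cV[R]_n)
    (V : (nat -> 'I_N) -> nat -> 'cV[R]_(l.+1 * n) -> R) : Prop :=
  exists (a1 a2 a3 : R -> R) (D0 : R),
    [/\ [/\ class_Koo a1, class_Koo a2, class_K a3 & 0 < D0],
        forall sigma k phi,
          a1 (enorm (block phi ord0)) <= V sigma k phi <= a2 (enorm phi)
      & forall sigma k0 x, is_solution l A B f u sigma k0 x ->
        forall k : nat, (k0 <= k)%N -> D0 <= enorm (segment l x k%:Z) ->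
          V sigma k.+1 (segment l x k.+1%:Z) - V sigma k (segment l x k%:Z)
            <= - a3 (enorm (segment l x k%:Z))].

Definition guarantees_uub (R : realType) (n N l : nat)
    (A B : 'I_N -> 'M[R]_n) (f : 'I_n -> R -> R) (u : nat -> 'cV[R]_n)
    (V : (nat -> 'I_N) -> nat -> 'cV[R]_(l.+1 * n) -> R) : Prop :=
  LK_conditions A B f u V /\
  exists2 Rb : R, 0 < Rb & uniformly_ultimately_bounded l A B f u Rb.

(* Main.v *)
Require Import Defs.
From HB Require Import structures.
From mathcomp Require Import all_boot all_order all_algebra.
From mathcomp Require Import all_classical all_reals all_analysis.
From mathcomp Require Import ring lra.
Set Implicit Arguments.
Unset Strict Implicit.
Unset Printing Implicit Defensive.
Import Order.TTheory GRing.Theory Num.Theory.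
Import numFieldNormedType.Exports.
Local Open Scope classical_set_scope.
Local Open Scope ring_scope.

(** The functional is built from the two families of linear inequalities. The
    inequality on [theta] bounds row sums and the inequalities on the [d s]
    bound column sums; as in the Schur test, together they bound one step in
    the squared norm of weights [d s / theta] by the factor [lambda * mu < 1].
    By Cauchy-Schwarz with weights [theta],
<<
      (A z + B w)_i ^ 2 <= lambda theta_i (A (z^2 / theta) + B (w^2 / theta))_i
>>
    and summing against [d r / theta] transposes the matrices onto [d r]
    ([weighted_step]). The input is a third term of the Cauchy-Schwarz
    inequality, of weight [eta * theta]; it replaces [lambda] by
    [L = lambda + eta], and [eta] is small enough for [L * mu < 1] to persist.

    Take [P s = diag (d s / theta)], and let [b] be the componentwise maximum
    of the vectors [(B m)^T *m d j], so that [(A s)^T *m d r + b <= mu * d s]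
    still holds ([common_delay_weight]). With the weights
    [(L * b + eps * (l - i)) / theta] on the delay line, the matrix Q_l
    dominates the delayed term [L * (B s)^T *m d r], Q_1 charges
    [L * b + l * eps] to the current term, and successive weights differ by
    [eps / theta]. Since [|f_j t| <= |t|], the term [- x^T P x] provides
    [- d s] against the same weighted squares of [f x], and [L * mu < 1] leaves
    room for [(l + 1) * eps]. Hence the increment is at most
<<
      C - eps * sum over i <= l, j of f_j (x_j (k - i)) ^ 2 / theta_j
>>
    uniformly in the switching law ([LK_increment]). The components of [f]
    diverge, so the sum exceeds [(C + 1) / eps] outside a ball
    ([delayed_energy_coercive]); there the increment is at most [-1], hence at
    most [- (1 - exp (- |phi|))], while inside the ball it is at most [C]. These
    two facts and the quadratic bounds of the functional
    ([switched_LK_sandwich]) give uniform ultimate boundedness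
    ([LK_uniformly_ultimately_bounded]). *)

(** * Finite families of reals and Euclidean norms *)

Lemma pos_lower_bound (R : realType) (I : finType) (F : I -> R) :
  (forall i, 0 < F i) -> exists2 c : R, 0 < c & forall i, c <= F i.
Proof.
move=> F_gt0; exists (\big[Num.min/1]_i F i); first exact: lt_bigmin.
by move=> i; exact: bigmin_le.
Qed.

Lemma pos_upper_bound (R : realType) (I : finType) (F : I -> R) :
  exists2 c : R, 0 < c & forall i, F i <= c.
Proof.
exists (Num.max 1 (\big[Num.max/1]_i F i)); first by rewrite lt_max ltr01.
by move=> i; rewrite le_max le_bigmax orbT.
Qed.

Lemma enorm_ge0 (R : realType) (p : nat) (x : 'cV[R]_p) : 0 <= enorm x.
Proof. exact: sqrtr_ge0. Qed.

Lemma enorm_sqr (R : realType) (p : nat) (x : 'cV[R]_p) :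
  enorm x ^+ 2 = \sum_(i < p) x i 0 ^+ 2.
Proof. by rewrite sqr_sqrtr // sumr_ge0 // => i _; exact: sqr_ge0. Qed.

Lemma coord_sqr_le_enorm (R : realType) (p : nat) (x : 'cV[R]_p) i :
  x i 0 ^+ 2 <= enorm x ^+ 2.
Proof.
by rewrite enorm_sqr (bigD1 i) //= lerDl sumr_ge0 // => j _; exact: sqr_ge0.
Qed.

(** A vector of large Euclidean norm has a large coordinate; this is how
    one-dimensional divergence of the nonlinearities is turned into coercivity
    on the delayed state space. *)
Lemma large_coord (R : realType) (p : nat) (x : 'cV[R]_p) (T : R) :
  0 <= T -> 1 + p%:R * T ^+ 2 <= enorm x -> exists i, T <= `|x i 0|.
Proof.
move=> T_ge0 xT; apply: contrapT => /forallNP small.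
have : enorm x ^+ 2 <= p%:R * T ^+ 2.
  rewrite enorm_sqr -[X in X%:R]card_ord -sumr_const mulr_suml.
  apply: ler_sum => i _; rewrite mul1r -real_normK ?num_real //.
  have /negP := small i; rewrite -ltNge => /ltW xi.
  by rewrite ler_sqr ?nnegrE.
have pT : 0 <= p%:R * T ^+ 2 by rewrite mulr_ge0 // sqr_ge0.
nra.
Qed.

Lemma enorm_blocks (R : realType) (n l : nat) (phi : 'cV[R]_(l.+1 * n)) :
  enorm phi ^+ 2 = \sum_(i < l.+1) \sum_(j < n) block phi i j 0 ^+ 2.
Proof.
rewrite enorm_sqr (reindex _ (curry_mxvec_bij l.+1 n)) pair_bigA /=.
by apply: eq_bigr => -[i j] _ /=; rewrite mxE.
Qed.

(** * Diagonal functionals *)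

Lemma qform_diag (R : realType) (p : nat) (c : 'I_p -> R) (x : 'cV[R]_p) :
  qform (diag_mx (\row_j c j)) x = \sum_j c j * x j 0 ^+ 2.
Proof.
rewrite /qform -mulmxA mxE; apply: eq_bigr => j _.
by rewrite mul_diag_mx !mxE; ring.
Qed.

Lemma posdef_diag (R : realType) (p : nat) (c : 'I_p -> R) :
  (forall j, 0 < c j) -> posdef (diag_mx (\row_j c j)).
Proof.
move=> c_gt0; split=> [|x]; first by rewrite tr_diag_mx.
case/cV0Pn=> i xi; rewrite qform_diag (bigD1 i) //=.
apply: ltr_pwDl; first by rewrite mulr_gt0 // exprn_even_gt0.
by apply: sumr_ge0 => j _; rewrite mulr_ge0 ?sqr_ge0 // ltW.
Qed.

Lemma switched_LK_diag (R : realType) (n N l : nat) (p : 'I_N -> 'I_n -> R)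
    (q : 'I_l -> 'I_n -> R) (f : 'I_n -> R -> R) sigma k
    (phi : 'cV[R]_(l.+1 * n)) :
  switched_LK (fun s => diag_mx (\row_j p s j)) (fun i => diag_mx (\row_j q i j))
    f sigma k phi
  = \sum_j p (sigma k) j * block phi ord0 j 0 ^+ 2
    + \sum_i \sum_j q i j * f j (block phi (lift ord0 i) j 0) ^+ 2.
Proof.
rewrite /switched_LK qform_diag; congr (_ + _).
by apply: eq_bigr => i _; rewrite qform_diag; apply: eq_bigr => j _; rewrite !mxE.
Qed.

(** The two quadratic comparison functions. The upper one is where the bound
    of the nonlinearities by the identity is used. *)
Lemma switched_LK_sandwich (R : realType) (n N l : nat) (p : 'I_N -> 'I_n -> R)
    (q : 'I_l -> 'I_n -> R) (f : 'I_n -> R -> R) :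
  (forall s j, 0 < p s j) -> (forall i j, 0 < q i j) ->
  (forall i t, `|f i t| <= `|t|) ->
  exists c1 c2 : R, [/\ 0 < c1, 0 < c2 & forall sigma k phi,
    c1 * enorm (block phi ord0) ^+ 2 <=
    switched_LK (fun s => diag_mx (\row_j p s j))
      (fun i => diag_mx (\row_j q i j)) f sigma k phi
    <= c2 * enorm phi ^+ 2].
Proof.
move=> p_gt0 q_gt0 f_le.
have f_sqr j t : f j t ^+ 2 <= t ^+ 2.
  by rewrite -(real_normK (num_real t)) -(real_normK (num_real (f j t)))
    ler_sqr ?nnegrE.
have [c1 c1_gt0 c1_le] := pos_lower_bound (fun sj => p_gt0 sj.1 sj.2).
have [cp cp_gt0 le_cp] := pos_upper_bound (fun sj : 'I_N * 'I_n => p sj.1 sj.2).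
have [cq cq_gt0 le_cq] := pos_upper_bound (fun ij : 'I_l * 'I_n => q ij.1 ij.2).
exists c1, (cp + cq); split=> //; first exact: addr_gt0.
move=> sigma k phi; rewrite switched_LK_diag enorm_sqr enorm_blocks.
apply/andP; split.
  apply: ler_wpDr.
    apply: sumr_ge0 => i _; apply: sumr_ge0 => j _.
    by rewrite mulr_ge0 ?sqr_ge0 // ltW.
  rewrite mulr_sumr; apply: ler_sum => j _.
  by rewrite ler_wpM2r ?sqr_ge0 // (c1_le (_, _)).
rewrite [in leRHS]big_ord_recl mulrDr; apply: lerD.
  rewrite mulr_sumr; apply: ler_sum => j _; rewrite ler_wpM2r ?sqr_ge0 //.
  by rewrite (le_trans (le_cp (_, _))) // lerDl ltW.
rewrite mulr_sumr; apply: ler_sum => i _.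
rewrite mulr_sumr; apply: ler_sum => j _.
apply: ler_pM; rewrite ?sqr_ge0 ?f_sqr //; first exact: ltW.
by rewrite (le_trans (le_cq (_, _))) // lerDr ltW.
Qed.

(** * Comparison functions *)

Lemma class_Koo_sqr (R : realType) (c : R) :
  0 < c -> class_Koo (fun t => c * t ^+ 2).
Proof.
move=> c_gt0; split; last exact: (gt0_cvgMry c_gt0 cvgr_expr2).
split.
- apply: continuous_subspaceT => t.
  by apply: cvgM; [exact: cvg_cst|exact: exprn_continuous].
- by rewrite expr0n mulr0.
- move=> s t s_ge0 st; rewrite ltr_pM2l // ltr_sqr // nnegrE //.
  exact: le_trans (ltW st).
Qed.

Lemma class_K_exp (R : realType) : class_K (fun t : R => 1 - expR (- t)).
Proof.
split.
- apply: continuous_subspaceT => t; apply: cvgB; first exact: cvg_cst.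
  apply: continuous_comp; first exact: opp_continuous.
  exact: continuous_expR.
- by rewrite oppr0 expR0 subrr.
- by move=> s t _ st; rewrite ltrD2l ltrN2 ltr_expR ltrN2.
Qed.

(** * Ultimate boundedness from a Lyapunov-Krasovskii functional *)

(** Outside the ball of radius [D0] the functional drops by at least [a3 D0]
    per step, and from inside it jumps to at most [a2 D0 + C]. Hence, started
    from data of norm at most [D], after [m] steps it is at most the larger of
    [a2 D0 + C] and [a2 D - m * a3 D0], and the second bound loses after a
    number of steps that depends on [D] only. *)
Lemma LK_uniformly_ultimately_bounded (R : realType) (n N l : nat)
    (A B : 'I_N -> 'M[R]_n) (f : 'I_n -> R -> R) (u : nat -> 'cV[R]_n)
    (V : (nat -> 'I_N) -> nat -> 'cV[R]_(l.+1 * n) -> R) (C : R) :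
  LK_conditions A B f u V ->
  (forall sigma k0 x, is_solution l A B f u sigma k0 x ->
    forall k : nat, (k0 <= k)%N ->
      V sigma k.+1 (segment l x k.+1%:Z) - V sigma k (segment l x k%:Z) <= C) ->
  exists2 Rb : R, 0 < Rb & uniformly_ultimately_bounded l A B f u Rb.
Proof.
move=> [a1 [a2 [a3 [D0 [[[_ a1y] [[_ _ a2_mono] _] [_ a3_0 a3_mono] D0_gt0]]]]]].
move=> V_bnd V_decr V_jump.
have a2_le s t : 0 <= s -> s <= t -> a2 s <= a2 t.
  by move=> s_ge0; rewrite le_eqVlt => /predU1P[->//|st]; exact/ltW/a2_mono.
have a3_le s t : 0 <= s -> s <= t -> a3 s <= a3 t.
  by move=> s_ge0; rewrite le_eqVlt => /predU1P[->//|st]; exact/ltW/a3_mono.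
have a3D0 : 0 < a3 D0 by rewrite -[ltLHS]a3_0 a3_mono.
pose M := a2 D0 + C.
have [T [_ a1T]] : \forall t \near +oo, M < a1 t.
  by have /cvgryPgt := a1y; apply.
exists (Num.max 1 T); first by rewrite lt_max ltr01.
move=> D D_gt0; exists (Num.bound `|(a2 D - M) / a3 D0|).+1 => //.
move=> sigma k0 x x_sol x_init k k_large.
have V_le m : V sigma (k0 + m)%N (segment l x (k0 + m)%N%:Z)
    <= Num.max M (a2 D - m%:R * a3 D0).
  elim: m => [|m IHm].
    have /andP[_ V_le] := V_bnd sigma k0 (segment l x k0%:Z).
    rewrite addn0 mul0r subr0 le_max; apply/orP; right.
    by apply: le_trans V_le _; exact: a2_le (enorm_ge0 _) x_init.
  have k0m : (k0 <= k0 + m)%N by exact: leq_addr.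
  rewrite addnS; have [out|inn] := leP D0 (enorm (segment l x (k0 + m)%N%:Z)).
    have := V_decr _ _ _ x_sol _ k0m out.
    have := a3_le _ _ (ltW D0_gt0) out.
    move: IHm; rewrite -natr1 !le_max => /orP[VM|VD] a3V decr.
      by apply/orP; left; lra.
    by apply/orP; right; lra.
  have := V_jump _ _ _ x_sol _ k0m.
  have /andP[_ V_le] := V_bnd sigma (k0 + m)%N (segment l x (k0 + m)%N%:Z).
  have := a2_le _ _ (enorm_ge0 _) (ltW inn).
  by rewrite le_max /M => *; apply/orP; left; lra.
rewrite leNgt; apply/negP; rewrite gt_max => /andP[_ /a1T].
apply/negP; rewrite -leNgt.
have [m kE] : exists m, (k = k0 + m)%N.
  exists (k - k0)%N; rewrite subnKC //; apply: leq_trans k_large.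
  exact: leq_addl.
have /andP[+ _] := V_bnd sigma k (segment l x k%:Z).
rewrite block_segment subr0 => /le_trans; apply.
have := V_le m; rewrite -kE => /le_trans; apply.
rewrite ge_max lexx /= lerBlDr -lerBlDl -ler_pdivrMr //.
apply: le_trans (ler_norm _) _.
apply: le_trans (ltW (archi_boundP (normr_ge0 _))) _.
by rewrite ler_nat; move: k_large; rewrite kE addnC leq_add2l; exact: ltnW.
Qed.

(** * One step of the system in weighted norms *)

Lemma weighted_young (R : realType) (I : finType) (a z theta : I -> R) (t : R) :
  (forall j, 0 <= a j) -> (forall j, 0 < theta j) ->
  2 * t * (\sum_j a j * z j)
  <= \sum_j a j * (z j ^+ 2 / theta j) + t ^+ 2 * \sum_j a j * theta j.
Proof.
move=> a_ge0 theta_gt0; rewrite !mulr_sumr -big_split /=.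
apply: ler_sum => j _; rewrite -subr_ge0.
have th0 : theta j != 0 by rewrite gt_eqF.
rewrite [leRHS](_ : _ = a j * ((z j - t * theta j) ^+ 2 / theta j)); last first.
  by field.
by rewrite mulr_ge0 // divr_ge0 ?sqr_ge0 // ltW.
Qed.

(** A Cauchy-Schwarz inequality for the three contributions to one component
    of the next state, with weights [theta], [theta] and [eta * vartheta].
    The total weight is bounded by [L], and the weighted Young inequality is
    optimal at [t = y / L]. *)
Lemma weighted_cauchy_schwarz (R : realType) (I : finType)
    (a b z w theta : I -> R) (v eta vartheta L : R) :
  (forall j, 0 <= a j) -> (forall j, 0 <= b j) -> (forall j, 0 < theta j) ->
  0 < eta * vartheta -> 0 < L ->
  \sum_j a j * theta j + \sum_j b j * theta j + eta * vartheta <= L ->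
  (\sum_j a j * z j + \sum_j b j * w j + v) ^+ 2
  <= L * (\sum_j a j * (z j ^+ 2 / theta j)
          + \sum_j b j * (w j ^+ 2 / theta j) + v ^+ 2 / (eta * vartheta)).
Proof.
move=> a_ge0 b_ge0 theta_gt0 e_gt0 L_gt0.
set ya := \sum_j a j * z j; set yb := \sum_j b j * w j.
set Sa := \sum_j a j * theta j; set Sb := \sum_j b j * theta j.
set Qa := \sum_j a j * (_ / _); set Qb := \sum_j b j * (_ / _).
set e := eta * vartheta in e_gt0 * => SL.
pose y := ya + yb + v; pose t := y / L.
have Ya : 2 * t * ya <= Qa + t ^+ 2 * Sa by exact: weighted_young.
have Yb : 2 * t * yb <= Qb + t ^+ 2 * Sb by exact: weighted_young.
have Yv : 2 * t * v <= v ^+ 2 / e + t ^+ 2 * e.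
  rewrite -subr_ge0 (_ : _ - _ = (v - t * e) ^+ 2 / e).
    by rewrite divr_ge0 ?sqr_ge0 // ltW.
  by field; rewrite gt_eqF.
have St : t ^+ 2 * (Sa + Sb + e) <= t ^+ 2 * L by rewrite ler_wpM2l ?sqr_ge0.
have tL : t * L = y by rewrite /t mulfVK // gt_eqF.
have ttL : t ^+ 2 * L = t * y by rewrite expr2 -mulrA tL.
have -> : (ya + yb + v) ^+ 2 = L * (t * y) by rewrite mulrA [L * t]mulrC tL.
rewrite ler_pM2l //; move: Ya Yb Yv St; rewrite ttL /y; nra.
Qed.

(** Summing the componentwise estimates against [d / theta] transposes the
    matrices: the hypothesis on [theta] controls the row sums, while the
    remaining factors are column sums against [d]. *)
Lemma weighted_step (R : realType) (n : nat) (A B : 'M[R]_n)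
    (d theta z w v : 'cV[R]_n) (lambda eta : R) :
  mx_nonneg A -> mx_nonneg B -> (forall i, 0 <= d i 0) -> vpos theta ->
  0 < lambda -> 0 < eta -> vle ((A + B) *m theta) (lambda *: theta) ->
  \sum_i d i 0 / theta i 0 * (A *m z + B *m w + v) i 0 ^+ 2
  <= (lambda + eta) * (\sum_j (A^T *m d) j 0 * (z j 0 ^+ 2 / theta j 0)
       + \sum_j (B^T *m d) j 0 * (w j 0 ^+ 2 / theta j 0)
       + \sum_i d i 0 * (v i 0 ^+ 2 / (eta * theta i 0))).
Proof.
move=> A_ge0 B_ge0 d_ge0 theta_gt0 lambda_gt0 eta_gt0 theta_le.
have trE (M : 'M[R]_n) (g : 'I_n -> R) :
    \sum_j (M^T *m d) j 0 * g j = \sum_i d i 0 * \sum_j M i j * g j.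
  under eq_bigr do rewrite mxE mulr_suml.
  rewrite exchange_big /=; apply: eq_bigr => i _; rewrite mulr_sumr.
  by apply: eq_bigr => j _; rewrite !mxE; ring.
rewrite !trE -!big_split /= mulr_sumr; apply: ler_sum => i _.
have th0 : 0 < theta i 0 by [].
have := @weighted_cauchy_schwarz R 'I_n (A i) (B i) (z^~ 0) (w^~ 0) (theta^~ 0)
  (v i 0) eta (theta i 0) ((lambda + eta) * theta i 0) (A_ge0 i) (B_ge0 i)
  theta_gt0.
have -> : \sum_j A i j * z j 0 + \sum_j B i j * w j 0 + v i 0
    = (A *m z + B *m w + v) i 0 by rewrite !mxE.
move=> /(_ (mulr_gt0 eta_gt0 th0) (mulr_gt0 (addr_gt0 lambda_gt0 eta_gt0) th0)).
have S_le : \sum_j A i j * theta j 0 + \sum_j B i j * theta j 0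
    + eta * theta i 0 <= (lambda + eta) * theta i 0.
  rewrite mulrDl lerD2r; have := theta_le i.
  by rewrite mulmxDl !mxE.
move=> /(_ S_le) row_le.
apply: le_trans (ler_wpM2l _ row_le) _; first by rewrite divr_ge0 // ltW.
rewrite le_eqVlt; apply/orP; left; apply/eqP; field.
by rewrite !gt_eqF.
Qed.

(** * The weights of the functional *)

(** One vector [b] dominates all products [(B m)^T *m d r]: the hypothesis on
    [d] is uniform in [m] and [j] for each coordinate, so their componentwise
    maximum still satisfies it. *)
Lemma common_delay_weight (R : realType) (n N : nat) (A B : 'I_N -> 'M[R]_n)
    (mu : R) (d : 'I_N -> 'cV[R]_n) :
  (forall s, mx_nonneg (B s)) -> (forall s, vpos (d s)) ->
  (forall s r m j : 'I_N,
     vle ((A s)^T *m d r + (B m)^T *m d j) (mu *: d s)) ->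
  exists b : 'I_n -> R, [/\ forall j, 0 <= b j,
    forall m r j, ((B m)^T *m d r) j 0 <= b j
  & forall s r j, ((A s)^T *m d r) j 0 + b j <= mu * d s j 0].
Proof.
move=> B_ge0 d_gt0 d_ineq.
exists (fun j => \big[Num.max/0]_(mr : 'I_N * 'I_N)
                   ((B mr.1)^T *m d mr.2) j 0); split.
- by move=> j; exact: bigmax_ge_id.
- by move=> m r j; exact: (le_bigmax _ _ (m, r)).
- move=> s r j; rewrite addrC -lerBrDr; apply: bigmax_le => [|[m k] _] /=.
    have := d_ineq s r s s j; rewrite [in leLHS]mxE [in leRHS]mxE.
    rewrite subr_ge0; apply: le_trans; rewrite lerDl mxE sumr_ge0 // => i _.
    by rewrite mulr_ge0 ?mxE ?B_ge0 // ltW // d_gt0.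
  have := d_ineq s r m k j; rewrite [in leLHS]mxE [in leRHS]mxE.
  by rewrite lerBrDr addrC.
Qed.

Lemma telescope_ord_sum (R : pzRingType) (l : nat) (g : nat -> R) :
  \sum_(i < l) (g i - g i.+1) = g 0%N - g l.
Proof.
have := telescope_sumr g (leq0n l); rewrite big_mkord => tele.
rewrite -[RHS]opprB -tele -sumrN.
by apply: eq_bigr => i _; rewrite opprB.
Qed.

(** Abel summation: weights decreasing by one along the delay line leave a
    copy of every delayed term. *)
Lemma delay_line_sum (R : comRingType) (l : nat) (g : nat -> R) :
  \sum_(i < l) (l%:R - i%:R) * (g i - g i.+1)
  = l.+1%:R * g 0%N - \sum_(i < l.+1) g i.
Proof.
elim: l => [|l IHl]; first by rewrite big_ord0 big_ord1 mul1r subrr.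
have -> : \sum_(i < l.+1) (l.+1%:R - i%:R) * (g i - g i.+1)
    = \sum_(i < l.+1) (l%:R - i%:R) * (g i - g i.+1)
      + \sum_(i < l.+1) (g i - g i.+1).
  by rewrite -big_split; apply: eq_bigr => i _ /=; rewrite -natr1; ring.
rewrite big_ord_recr /= subrr mul0r addr0 IHl.
rewrite telescope_ord_sum.
by rewrite [in RHS]big_ord_recr /= -[in RHS]natr1; ring.
Qed.

(** * Coercivity of the decrease, and the increment estimate *)

(** The components diverge at both infinities, so the squared nonlinearities
    summed over the delayed state are coercive; saturating components would
    make the sum bounded, and a large input could then outweigh it. *)
Lemma delayed_energy_coercive (R : realType) (n l : nat) (f : 'I_n -> R -> R)
    (theta : 'cV[R]_n) (K : R) :
  (forall i, f i t @[t --> -oo] --> -oo) ->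
  (forall i, f i t @[t --> +oo] --> +oo) -> vpos theta ->
  exists2 D0 : R, 0 < D0 & forall phi : 'cV[R]_(l.+1 * n), D0 <= enorm phi ->
    K <= \sum_(i < l.+1) \sum_j f j (block phi i j 0) ^+ 2 / theta j 0.
Proof.
move=> f_ninfty f_pinfty theta_gt0.
have /choice[T T_large] : forall j, exists T : R, forall t, T <= `|t| ->
    K <= f j t ^+ 2 / theta j 0.
  move=> j; pose G := 1 + `|K * theta j 0|.
  have [a [_ f_a]] : \forall t \near +oo, G <= f j t.
    by have /cvgryPge := f_pinfty j; apply.
  have [b [_ f_b]] : \forall t \near -oo, f j t <= - G.
    by have /cvgrNyPle := f_ninfty j; apply.
  exists (1 + `|a| + `|b|) => t t_large.
  have G_ge1 : 1 <= G by rewrite lerDl.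
  have KG : K * theta j 0 <= G.
    by rewrite (le_trans (ler_norm _)) // lerDr.
  rewrite ler_pdivlMr //; apply: le_trans KG _.
  have [t_ge0|t_lt0] := ger0P t.
    have /f_a : a < t.
      move: t_large; rewrite (ger0_norm t_ge0).
      by have := ler_norm a; have := normr_ge0 b; lra.
    by nra.
  have /f_b : t < b.
    move: t_large; rewrite (ltr0_norm t_lt0).
    by have := ler_norm (- b); have := normr_ge0 a; rewrite normrN; lra.
  by nra.
have [T0 T0_gt0 T_le] := pos_upper_bound T.
exists (1 + (l.+1 * n)%:R * T0 ^+ 2).
  by rewrite ltr_pwDl // mulr_ge0 // sqr_ge0.
have term_ge0 (phi : 'cV[R]_(l.+1 * n)) i j :
    0 <= f j (block phi i j 0) ^+ 2 / theta j 0.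
  by rewrite divr_ge0 ?sqr_ge0 // ltW.
move=> phi /(large_coord (ltW T0_gt0))[k]; case/mxvec_indexP: k => i j phi_ij.
have := T_large j (phi (mxvec_index i j) 0) (le_trans (T_le j) phi_ij).
move=> /le_trans; apply.
rewrite (bigD1 i) //= (bigD1 j) //= mxE -addrA lerDl addr_ge0 ?sumr_ge0 //.
by move=> i' _; exact: sumr_ge0.
Qed.

(** The key estimate: along solutions the functional decreases by [eps] times
    the coercive energy, up to the bounded contribution [C] of the input. The
    weights of the delay line absorb the delayed term, at the cost of adding
    [L * b + l * eps] to the weight of the current term; the slack in
    [L * mu < 1] pays for it. *)
Lemma LK_increment (R : realType) (n N l : nat)
    (A B : 'I_N -> 'M[R]_n) (f : 'I_n -> R -> R) (u : nat -> 'cV[R]_n)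
    (mu lambda eta eps : R) (d : 'I_N -> 'cV[R]_n) (theta : 'cV[R]_n)
    (b : 'I_n -> R) :
  (forall s, mx_nonneg (A s)) -> (forall s, mx_nonneg (B s)) ->
  (forall i t, `|f i t| <= `|t|) -> bounded_input u ->
  0 < lambda -> 0 < eta -> (forall s, vpos (d s)) -> vpos theta ->
  (forall s, vle ((A s + B s) *m theta) (lambda *: theta)) ->
  (forall m r j, ((B m)^T *m d r) j 0 <= b j) ->
  (forall s r j, ((A s)^T *m d r) j 0 + b j <= mu * d s j 0) ->
  (forall s j, l.+1%:R * eps <= (1 - (lambda + eta) * mu) * d s j 0) ->
  let p s j := d s j 0 / theta j 0 in
  let q (i : 'I_l) j :=
    ((lambda + eta) * b j + eps * (l%:R - i%:R)) / theta j 0 in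
  let V := switched_LK (fun s => diag_mx (\row_j p s j))
             (fun i => diag_mx (\row_j q i j)) f in
  exists2 C : R, 0 <= C & forall sigma k0 x, is_solution l A B f u sigma k0 x ->
    forall k : nat, (k0 <= k)%N ->
      V sigma k.+1 (segment l x k.+1%:Z) - V sigma k (segment l x k%:Z)
      <= C - eps * \sum_(i < l.+1) \sum_j
               f j (block (segment l x k%:Z) i j 0) ^+ 2 / theta j 0.
Proof.
move=> A_ge0 B_ge0 f_le [M u_le] lambda_gt0 eta_gt0 d_gt0 theta_gt0 theta_le.
move=> Bd_le Ad_le eps_le p q V.
have th0 j : theta j 0 != 0 by rewrite gt_eqF.
set L := lambda + eta in eps_le q V *.
have L_gt0 : 0 < L by exact: addr_gt0.
exists (L * \sum_s \sum_i d s i 0 * (M ^+ 2 / (eta * theta i 0))).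
  rewrite mulr_ge0 ?(ltW L_gt0) //; apply: sumr_ge0 => s _; apply: sumr_ge0 => i _.
  have := d_gt0 s i; have := mulr_gt0 eta_gt0 (theta_gt0 i) => *.
  by rewrite mulr_ge0 ?divr_ge0 ?sqr_ge0 // ltW.
move=> sigma k0 x x_sol k k0k; rewrite /V !switched_LK_diag.
set s := sigma k; set r := sigma k.+1.
pose g (j : 'I_n) (i : nat) := f j (x (k%:Z - i%:Z) j 0) ^+ 2 / theta j 0.
have g_ge0 j i : 0 <= g j i by rewrite divr_ge0 ?sqr_ge0 // ltW.
have -> : \sum_(i < l.+1) \sum_j f j (block (segment l x k%:Z) i j 0) ^+ 2
      / theta j 0 = \sum_j \sum_(i < l.+1) g j i.
  rewrite exchange_big; apply: eq_bigr => j _; apply: eq_bigr => i _.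
  by rewrite block_segment.
(* The delay lines at times k and k+1 run over the same values of x, shifted
   by one place. *)
have -> : \sum_i \sum_j q i j
      * f j (block (segment l x k%:Z) (lift ord0 i) j 0) ^+ 2
    = \sum_j \sum_(i < l) (L * b j + eps * (l%:R - i%:R)) * g j i.+1.
  rewrite exchange_big; apply: eq_bigr => j _; apply: eq_bigr => i _.
  by rewrite block_segment lift0 /q /g; ring.
have -> : \sum_i \sum_j q i j
      * f j (block (segment l x k.+1%:Z) (lift ord0 i) j 0) ^+ 2
    = \sum_j \sum_(i < l) (L * b j + eps * (l%:R - i%:R)) * g j i.
  rewrite exchange_big; apply: eq_bigr => j _; apply: eq_bigr => i _.
  rewrite block_segment lift0 /q /g.
  have -> : (k.+1%:Z - i.+1%:Z = k%:Z - i%:Z)%R by rewrite !intS; ring.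
  by ring.
rewrite !block_segment !subr0 (x_sol k k0k) -/s.
have gE j i : (diag_map f (x (k%:Z - i%:Z))) j 0 ^+ 2 / theta j 0 = g j i.
  by rewrite mxE.
have step : \sum_j p r j * (A s *m diag_map f (x k%:Z)
          + B s *m diag_map f (x (k%:Z - l%:Z)) + u k) j 0 ^+ 2
    <= L * (\sum_j ((A s)^T *m d r) j 0 * g j 0%N
        + \sum_j ((B s)^T *m d r) j 0 * g j l
        + \sum_i d r i 0 * ((u k) i 0 ^+ 2 / (eta * theta i 0))).
  apply: le_trans (weighted_step _ _ _ (A_ge0 s) (B_ge0 s)
    (fun i => ltW (d_gt0 r i)) theta_gt0 lambda_gt0 eta_gt0 (theta_le s)) _.
  rewrite ler_pM2l // !lerD2r; apply: lerD; apply: ler_sum => j _.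
    by rewrite -gE subr0.
  by rewrite -gE.
have input_le : \sum_i d r i 0 * ((u k) i 0 ^+ 2 / (eta * theta i 0))
    <= \sum_s \sum_i d s i 0 * (M ^+ 2 / (eta * theta i 0)).
  have inv_ge0 i : 0 <= (eta * theta i 0)^-1 by rewrite invr_ge0 mulr_ge0 ?ltW.
  rewrite [leRHS](bigD1 r) //= ler_wpDr //.
    apply: sumr_ge0 => s' _; apply: sumr_ge0 => i _.
    by rewrite mulr_ge0 ?(ltW (d_gt0 _ _)) // mulr_ge0 ?sqr_ge0.
  apply: ler_sum => i _; rewrite ler_wpM2l ?(ltW (d_gt0 _ _)) // ler_wpM2r //.
  apply: le_trans (coord_sqr_le_enorm _ _) _.
  by rewrite ler_sqr ?nnegrE ?enorm_ge0 // (le_trans (enorm_ge0 (u k))).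
have current_ge : \sum_j d s j 0 * g j 0%N <= \sum_j p s j * (x k%:Z) j 0 ^+ 2.
  apply: ler_sum => j _; rewrite /g /p subr0 [leRHS]mulrAC -mulrA.
  rewrite ler_wpM2l ?(ltW (d_gt0 _ _)) //.
  rewrite ler_wpM2r ?invr_ge0 ?(ltW (theta_gt0 _)) //.
  by rewrite -(real_normK (num_real (f j _))) -(real_normK (num_real (x _ _ _)))
    ler_sqr ?nnegrE.
have delay_line :
    \sum_j \sum_(i < l) (L * b j + eps * (l%:R - i%:R)) * g j i
    - \sum_j \sum_(i < l) (L * b j + eps * (l%:R - i%:R)) * g j i.+1
    = \sum_j (L * b j * (g j 0%N - g j l)
      + eps * (l.+1%:R * g j 0%N - \sum_(i < l.+1) g j i)).
  rewrite -sumrB; apply: eq_bigr => j _.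
  rewrite -delay_line_sum -sumrB !mulr_sumr.
  rewrite -telescope_ord_sum.
  by rewrite mulr_sumr -big_split; apply: eq_bigr => i _ /=; ring.
(* All sums over coordinates are now merged, and the estimate is proved
   coordinate by coordinate. *)
have main : L * (\sum_j ((A s)^T *m d r) j 0 * g j 0%N
        + \sum_j ((B s)^T *m d r) j 0 * g j l)
    - \sum_j d s j 0 * g j 0%N
    + \sum_j (L * b j * (g j 0%N - g j l)
        + eps * (l.+1%:R * g j 0%N - \sum_(i < l.+1) g j i))
    <= - (eps * \sum_j \sum_(i < l.+1) g j i).
  rewrite -big_split /= !mulr_sumr -!sumrN -!big_split /=.
  apply: ler_sum => j _; set S := \sum_(i < l.+1) _.
  have h1 : L * (((A s)^T *m d r) j 0 + b j) * g j 0%N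
      <= L * (mu * d s j 0) * g j 0%N.
    by rewrite ler_wpM2r // ler_wpM2l // ltW.
  have h2 : L * ((B s)^T *m d r) j 0 * g j l <= L * b j * g j l.
    by rewrite ler_wpM2r // ler_wpM2l // ltW.
  have h3 : l.+1%:R * eps * g j 0%N <= (1 - L * mu) * d s j 0 * g j 0%N.
    by rewrite ler_wpM2r.
  by move: h1 h2 h3; lra.
move: step main current_ge (ler_wpM2l (ltW L_gt0) input_le).
by rewrite -delay_line /p; lra.
Qed.

(** * The ultimate boundedness theorem *)

Theorem theorem6p5 (R : realType) (n N l : nat)
  (n_gt0 : (0 < n)%N) (N_gt0 : (0 < N)%N) (l_gt0 : (0 < l)%N)
  (A B : 'I_N -> 'M[R]_n)
  (A_nonneg : forall s, mx_nonneg (A s)) (B_nonneg : forall s, mx_nonneg (B s))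
  (f : 'I_n -> R -> R) (f_adm : admissible f)
  (u : nat -> 'cV[R]_n) (u_bnd : bounded_input u)
  (f_ninfty : forall i, f i t @[t --> -oo] --> -oo)
  (f_pinfty : forall i, f i t @[t --> +oo] --> +oo)
  (mu lambda : R) (mu_gt0 : 0 < mu) (lambda_gt0 : 0 < lambda)
  (d : 'I_N -> 'cV[R]_n) (theta : 'cV[R]_n)
  (d_pos : forall s, vpos (d s)) (theta_pos : vpos theta)
  (d_ineq : forall s r m j : 'I_N,
     vle ((A s)^T *m d r + (B m)^T *m d j) (mu *: d s))
  (theta_ineq : forall s : 'I_N,
     vle ((A s + B s) *m theta) (lambda *: theta))
  (lambda_mu : lambda * mu < 1) :
  exists (P : 'I_N -> 'M[R]_n) (Q : 'I_l -> 'M[R]_n),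
    [/\ forall s, is_diag_mx (P s) /\ posdef (P s),
        forall i, is_diag_mx (Q i) /\ posdef (Q i)
      & guarantees_uub A B f u (switched_LK P Q f)].
Proof.
have [_ _ f_le] := f_adm.
have [b [b_ge0 Bd_le Ad_le]] := common_delay_weight B_nonneg d_pos d_ineq.
(* Half of the slack in lambda * mu < 1 absorbs the input. *)
pose eta := (1 - lambda * mu) / (2 * mu).
have eta_gt0 : 0 < eta by rewrite divr_gt0 ?mulr_gt0 ?subr_gt0.
have L_mu : (lambda + eta) * mu = (1 + lambda * mu) / 2.
  by rewrite /eta; field; rewrite gt_eqF.
have slack_gt0 : 0 < 1 - (lambda + eta) * mu by rewrite L_mu; lra.
have [dm dm_gt0 dm_le] := pos_lower_bound (fun sj => d_pos sj.1 sj.2).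
pose eps := (1 - (lambda + eta) * mu) * dm / l.+1%:R.
have eps_gt0 : 0 < eps by rewrite divr_gt0 ?mulr_gt0.
have eps_le s j : l.+1%:R * eps <= (1 - (lambda + eta) * mu) * d s j 0.
  rewrite /eps mulrC divfK ?pnatr_eq0 // ler_wpM2l ?(ltW slack_gt0) //.
  exact: (dm_le (s, j)).
pose p s j := d s j 0 / theta j 0.
pose q (i : 'I_l) j :=
  ((lambda + eta) * b j + eps * (l%:R - i%:R)) / theta j 0.
pose V := switched_LK (fun s => diag_mx (\row_j p s j))
            (fun i => diag_mx (\row_j q i j)) f.
have [C C_ge0 V_incr] : exists2 C : R, 0 <= C &
    forall sigma k0 x, is_solution l A B f u sigma k0 x ->
    forall k : nat, (k0 <= k)%N ->
      V sigma k.+1 (segment l x k.+1%:Z) - V sigma k (segment l x k%:Z)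
      <= C - eps * \sum_(i < l.+1) \sum_j
               f j (block (segment l x k%:Z) i j 0) ^+ 2 / theta j 0.
  exact: (LK_increment A_nonneg B_nonneg f_le u_bnd lambda_gt0 eta_gt0 d_pos
    theta_pos theta_ineq Bd_le Ad_le eps_le).
have p_gt0 s j : 0 < p s j by rewrite divr_gt0 // d_pos.
have q_gt0 i j : 0 < q i j.
  have : 0 <= (lambda + eta) * b j by rewrite mulr_ge0 // ltW ?addr_gt0.
  have : 0 < eps * (l%:R - i%:R) by rewrite mulr_gt0 // subr_gt0 ltr_nat.
  by move=> *; rewrite divr_gt0 // ltr_wpDl.
exists (fun s => diag_mx (\row_j p s j)), (fun i => diag_mx (\row_j q i j)).
split; try by move=> ?; split; [exact: diag_mx_is_diag|exact: posdef_diag].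
have [c1 [c2 [c1_gt0 c2_gt0 V_bnd]]] := switched_LK_sandwich p_gt0 q_gt0 f_le.
(* Outside the ball of radius D0 the decrease beats the input by a margin of 1,
   an upper bound of the comparison function a3 = 1 - exp(-t). *)
have [D0 D0_gt0 coercive] :=
  delayed_energy_coercive l ((C + 1) / eps) f_ninfty f_pinfty theta_pos.
have V_LK : LK_conditions A B f u V.
  exists (fun t => c1 * t ^+ 2), (fun t => c2 * t ^+ 2),
    (fun t => 1 - expR (- t)), D0; split => //.
    by split=> //; [exact: class_Koo_sqr|exact: class_Koo_sqr|exact: class_K_exp].
  move=> sigma k0 x x_sol k k0k /coercive.
  rewrite ler_pdivrMr // mulrC => energy_ge.
  have := V_incr sigma k0 x x_sol k k0k.
  have := expR_gt0 (- enorm (segment l x k%:Z)).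
  by move: energy_ge; lra.
split=> //; apply: (LK_uniformly_ultimately_bounded (C := C) V_LK).
move=> sigma k0 x x_sol k k0k; apply: le_trans (V_incr _ _ _ x_sol k k0k) _.
rewrite gerBl mulr_ge0 ?(ltW eps_gt0) //.
apply: sumr_ge0 => i _; apply: sumr_ge0 => j _.
by rewrite divr_ge0 ?sqr_ge0 // ltW.
Qed.
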